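(* Let $\mathcal{M}$ be a von Neumann algebra equipped with a normal faithful tracial state $\tau$. Suppose that $Y_\infty \subset Y_1$ is a contractive inclusion of Banach spaces, and for $1<p<\infty$ let $Y_p = (Y_\infty,Y_1)_{\frac1p}$ be the complex interpolation space. Let $P_p \colon \mathrm{L}^p(\mathcal{M})\to\mathrm{L}^p(\mathcal{M})$, $1<p<\infty$, be a family of bounded projections which are compatible on $\mathcal{M}$, in the sense that there exists a linear map $P \colon \mathcal{M}\to\mathcal{M}$ such that $P_p(x)=P(x)$ for any $x\in\mathcal{M}$ and any $p \in (1,\infty)$. Let $\partial \colon \mathrm{dom}\,\partial\subset\mathcal{M}\to Y_\infty$ be an unbounded linear operator. Assume that there exist constants $K>0$, $\beta>0$, $\alpha\geq 0$ and $p_0>1$ such that, for any $p\geq p_0$ (with $p<\infty$), $$\| x-P(x)\|_{\mathrm{L}^p(\mathcal{M})} \leq K p^\beta(\log p)^\alpha \|\partial x\|_{Y_p}, \quad x\in\mathrm{dom}\,\partial.$$ Then there exist constants $c_{\alpha,\beta}>0$ (depending only on $\alpha,\beta$) and $T_{\alpha,\beta,p_0}>0$ (depending only on $\alpha,\beta,p_0$) such that, for every $x\in\mathrm{dom}\,\partial$ with $\|\partial x\|_{Y_\infty}>0$, $$\tau\bigl(1_{(t,\infty)}(|x-P(x)|)\bigr) \leq \exp\left[-c_{\alpha,\beta}\,\frac{\left(\frac{t}{K\|\partial x\|_{Y_\infty}}\right)^{\frac1\beta}}{\left(\log\frac{t}{K\|\partial x\|_{Y_\infty}}\right)^{\frac{\alpha}{\beta}}}\right]$$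 for every $t\geq T_{\alpha,\beta,p_0}\,K\,\|\partial x\|_{Y_\infty}$.
   Context: $\mathrm{L}^p(\mathcal{M})$ is the noncommutative $\mathrm{L}^p$-space associated with $(\mathcal{M},\tau)$, with norm $\|a\|_{\mathrm{L}^p(\mathcal{M})}=\tau(|a|^p)^{1/p}$; since $\tau$ is finite, $\mathcal{M}\subset \mathrm{L}^p(\mathcal{M})$. For $a \in \mathcal{M}$, $|a|=(a^*a)^{1/2}$ and $1_{(t,\infty)}(|a|)$ is the spectral projection of $|a|$ given by the Borel functional calculus. $(Y_\infty,Y_1)_\theta$ denotes Calderón's complex interpolation method. *)

(* Defs.v *)
From HB Require Import structures.
From mathcomp Require Import all_boot all_order all_algebra.
From mathcomp Require Import all_classical all_reals all_analysis.
From mathcomp Require Import complex.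

Set Implicit Arguments.
Unset Strict Implicit.
Unset Printing Implicit Defensive.

Import Order.TTheory GRing.Theory Num.Theory.
Import numFieldNormedType.Exports.

Local Open Scope classical_set_scope.
Local Open Scope ring_scope.
Local Open Scope complex_scope.

(* Complex Banach spaces are [completeNormedModType R[i]]; their norm [`|x|]
   takes values in R[i], and [nrm x] is the same number seen in R.  The
   topological and normed structure of the complex plane sits on [R[i]^o]. *)
Definition nrm (R : realType) (V : normedModType R[i]) (x : V) : R :=
  complex.Re `|x|.

Section linear_on_subspaces.
Variables (K : nzRingType) (V W : lmodType K).

Definition subspace_set (D : set V) : Prop :=
  D 0 /\ forall (a : K) (x y : V), D x -> D y -> D (a *: x + y).

Definition linear_on (D : set V) (f : V -> W) : Prop :=
  forall (a : K) (x y : V), D x -> D y -> f (a *: x + y) = a *: f x + f y.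

End linear_on_subspaces.

Section von_Neumann_algebras.
Variables (R : realType) (H : completeNormedModType R[i]).
Variable dot : {dot H for @Num.conj R[i]}.

(* [dot] (linear in its first argument) turns the Banach space H into a
   Hilbert space. *)
Definition hilbert_norm : Prop := forall x : H, `|x| ^+ 2 = dot x x.

Definition bounded_op (a : H -> H) : Prop := linear a /\ continuous a.

Definition adjoint (a : H -> H) : H -> H :=
  xget (fun=> 0)
    [set b | bounded_op b /\ forall x y, dot (a x) y = dot x (b y)].

Definition commutant (A : set (H -> H)) : set (H -> H) :=
  [set b | bounded_op b /\ forall a, A a -> a \o b = b \o a].

Definition von_Neumann (M : set (H -> H)) : Prop :=
  (forall a, M a -> M (adjoint a)) /\ commutant (commutant M) = M.

Definition self_adjoint (a : H -> H) : Prop :=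
  forall x y, dot (a x) y = dot x (a y).

(* In R[i], [0 <= z] means that z is real and nonnegative. *)
Definition positive_op (a : H -> H) : Prop := forall x, 0 <= dot (a x) x.

Definition le_op (a b : H -> H) : Prop := positive_op (b - a).

Variable M : set (H -> H).

Definition is_lub_op (D : set (H -> H)) (a : H -> H) : Prop :=
  [/\ M a, self_adjoint a,
      forall d, D d -> le_op d a
    & forall b, M b -> self_adjoint b ->
        (forall d, D d -> le_op d b) -> le_op a b].

Record normal_faithful_tracial_state (tau : (H -> H) -> R[i]) : Prop := {
  trace_linear : linear_on M (tau : (H -> H) -> R[i]^o) ;
  trace_positive : forall a, M a -> positive_op a -> 0 <= tau a ;
  trace_unital : tau id = 1 ;
  trace_tracial : forall a b, M a -> M b -> tau (a \o b) = tau (b \o a) ;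
  trace_faithful : forall a, M a -> positive_op a -> tau a = 0 -> a = 0 ;
  trace_normal : forall (D : set (H -> H)) (a : H -> H),
    (forall d, D d -> M d /\ self_adjoint d) ->
    D !=set0 ->
    (forall d1 d2, D d1 -> D d2 ->
       exists d, [/\ D d, le_op d1 d & le_op d2 d]) ->
    is_lub_op D a ->
    complex.Re (tau a) = sup [set complex.Re (tau d) | d in D] }.

(* Projection-valued Borel measures on the real line.  They are taken with
   values in M, where the spectral projections of the self-adjoint elements
   of M live.  Idempotence of E B is [pvm_setI] with A = B. *)
Record projection_valued_measure (E : set R -> H -> H) : Prop := {
  pvm_in : forall B, measurable B -> M (E B) ;
  pvm_self_adjoint : forall B, measurable B -> self_adjoint (E B) ;
  pvm_setT : E setT = id ;
  pvm_setI : forall A B, measurable A -> measurable B ->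
    E (A `&` B) = E A \o E B ;
  pvm_sigma_additive : forall x : H,
    exists mu : {measure set R -> \bar R},
      forall B, measurable B -> mu B = (complex.Re (dot (E B x) x))%:E }.

(* b is the integral of f against E, tested against the scalar measures
   B |-> <E(B) x, x>; these diagonal values determine b by polarization. *)
Definition is_spectral_integral (E : set R -> H -> H) (f : R -> R)
    (b : H -> H) : Prop :=
  forall x : H, exists mu : {measure set R -> \bar R},
    [/\ forall B, measurable B -> mu B = (complex.Re (dot (E B x) x))%:E,
        mu.-integrable setT (EFin \o f)
      & dot (b x) x = (\int[mu]_(s in setT) f s)%:C].

(* The spectral measure of a self-adjoint a in M (it exists and is unique, by
   the spectral theorem). *)
Definition spectral_measure (a : H -> H) : set R -> H -> H :=
  xget (fun _ _ => 0)
    [set E | projection_valued_measure E /\ is_spectral_integral E id a].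

(* f(a), for a self-adjoint in M and f Borel and bounded on the spectrum. *)
Definition borel_calculus (f : R -> R) (a : H -> H) : H -> H :=
  xget (fun=> 0)
    [set b | M b /\ is_spectral_integral (spectral_measure a) f b].

Definition op_abs (a : H -> H) : H -> H :=
  borel_calculus Num.sqrt (adjoint a \o a).

Definition spectral_proj_gt (t : R) (a : H -> H) : H -> H :=
  borel_calculus \1_(`]t, +oo[) a.

Variable tau : (H -> H) -> R[i].

Definition Lp_norm (p : R) (a : H -> H) : R :=
  complex.Re (tau (borel_calculus (fun s => s `^ p) (op_abs a))) `^ p^-1.

(* L^p(M) is the completion of M for [Lp_norm p]: a Banach space L with a
   norm-preserving linear map iota from M onto a dense subspace of L. *)
Record is_noncommutative_Lp (p : R) (L : completeNormedModType R[i])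
    (iota : (H -> H) -> L) : Prop := {
  Lp_linear : linear_on M iota ;
  Lp_isometric : forall a, M a -> nrm (iota a) = Lp_norm p a ;
  Lp_dense : dense (iota @` M) }.

End von_Neumann_algebras.

Definition bounded_projection (R : realType) (L : completeNormedModType R[i])
    (Q : L -> L) : Prop :=
  [/\ linear Q, continuous Q & Q \o Q = Q].

Section complex_interpolation.
Variables (R : realType) (Y0 Y1 : completeNormedModType R[i]).

Definition contractive_inclusion (j : Y0 -> Y1) : Prop :=
  [/\ linear j, injective j & forall y, nrm (j y) <= nrm y].

Definition closed_strip : set R[i]^o := [set z | 0 <= complex.Re z <= 1].
Definition open_strip : set R[i]^o := [set z | 0 < complex.Re z < 1].

(* Calderon's space F(Y0, Y1) for Y0 contractively included in Y1 by j.  The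
   sum Y0 + Y1 is then Y1, with the same norm.  Here f0 t is f(it) seen as an
   element of Y0 (it is determined by f). *)
Record calderon_function (j : Y0 -> Y1) (f0 : R -> Y0) (f : R[i]^o -> Y1) :
    Prop := {
  calderon_continuous : {within closed_strip, continuous f} ;
  calderon_bounded :
    exists C : R, forall z, closed_strip z -> nrm (f z) <= C ;
  calderon_holomorphic : forall z, open_strip z -> derivable f z 1 ;
  calderon_left : forall t : R, f (0 +i* t) = j (f0 t) ;
  calderon_left_continuous : continuous f0 ;
  calderon_left_pinfty : f0 t @[t --> +oo] --> (0 : Y0) ;
  calderon_left_ninfty : f0 t @[t --> -oo] --> (0 : Y0) ;
  calderon_right_continuous : continuous (fun t : R => f (1 +i* t)) ;
  calderon_right_pinfty : f (1 +i* t) @[t --> +oo] --> (0 : Y1) ;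
  calderon_right_ninfty : f (1 +i* t) @[t --> -oo] --> (0 : Y1) }.

Definition calderon_norm (f0 : R -> Y0) (f : R[i]^o -> Y1) : \bar R :=
  maxe (ereal_sup (range (fun t : R => (nrm (f0 t))%:E)))
       (ereal_sup (range (fun t : R => (nrm (f (1 +i* t)))%:E))).

(* The norm of the complex interpolation space (Y0, Y1)_theta; it is +oo
   exactly at the points y of Y1 outside that space. *)
Definition interpolation_norm (j : Y0 -> Y1) (theta : R) (y : Y1) : \bar R :=
  ereal_inf [set N | exists f0 f,
    [/\ calderon_function j f0 f, f theta%:C = y & N = calderon_norm f0 f]].

End complex_interpolation.

(* Main.v *)
(* Testing the interpolation norm on f(z) = g(z) y, with g a rational function
   equal to 1 at 1/p and decaying along the strip, gives |y|_p <= 2 |y|_infty.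
   Chebyshev's inequality tau(1_(t,oo)(|a|)) <= (|a|_p / t)^p for a = x - P x
   then yields (2 K p^beta (log p)^alpha |y|_infty / t)^p, and
   p = c s^(1/beta) / (log s)^(alpha/beta), with s = t / (K |y|_infty) and c
   small, makes the base at most 1/e.

   The functional calculus is defined by choice, so Chebyshev's inequality needs
   the existence of |a|^p in M.  The spectral measure E of a bounded operator
   vanishes far to the right, so it suffices to integrate a bounded function
   0 <= g <= N.  If B_k is the set where the k-th binary digit of g / N is 1,
   the integral is the norm-convergent sum of the (N / 2^(k+1)) E(B_k), which
   lies in the double commutant. *)
Require Import Defs.
From HB Require Import structures.
From mathcomp Require Import all_boot all_order all_algebra.
From mathcomp Require Import all_classical all_reals all_analysis.
From mathcomp Require Import complex measurable_realfun ring lra.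

Set Implicit Arguments.
Unset Strict Implicit.
Unset Printing Implicit Defensive.

Import Order.TTheory GRing.Theory Num.Theory.
Import numFieldNormedType.Exports.

Local Open Scope classical_set_scope.
Local Open Scope ring_scope.
Local Open Scope complex_scope.

(** * Choice of the exponent *)

(** Put l = ln s. Since ln p is at most l / beta, the l^alpha coming from (ln p)^alpha cancels the
    l^(-alpha) in p^beta and leaves a constant times s. That constant is at most 1 / (2e) once [c]
    is small. *)
Lemma exponent_choice (R : realType) (alpha beta : R) :
  0 <= alpha -> 0 < beta ->
  exists2 c : R, 0 < c & forall p0 : R, 1 < p0 ->
  exists2 T : R, 0 < T & forall s, T <= s ->
    let p := c * (s `^ beta^-1 / ln s `^ (alpha / beta)) in
    p0 <= p /\ 2 * (p `^ beta * ln p `^ alpha) <= s * expR (- 1).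
Proof.
move=> a0 b0.
(* The bound imposed on c^beta: it satisfies 2 q beta^(-alpha) = exp(-1). *)
pose q := beta `^ alpha / 2 * expR (- 1).
have q0 : 0 < q by rewrite mulr_gt0 ?expR_gt0// divr_gt0 ?powR_gt0.
(* Together with ln s >= 1, the cap at 1 gives p <= s^(1/beta), hence the bound on ln p. *)
pose c := Num.min 1 (q `^ beta^-1).
have c0 : 0 < c by rewrite lt_min ltr01 powR_gt0.
have c1 : c <= 1 by rewrite ge_min lexx.
have cq : c `^ beta <= q.
  apply: (@le_trans _ _ ((q `^ beta^-1) `^ beta)).
    apply: ge0_ler_powR; rewrite ?nnegrE ?(ltW b0) ?(ltW c0) ?powR_ge0//.
    by rewrite ge_min lexx orbT.
  by rewrite -powRrM mulVf ?gt_eqF// powRr1// ltW.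
exists c => // p0 p01.
pose g := alpha / beta.
have g0 : 0 <= g by rewrite divr_ge0// ltW.
pose b := beta^-1.
have bp : 0 < b by rewrite invr_gt0.
(* From l <= exp(d l) / d follows l^g <= d^(-g) exp(d g l). This [d] makes d g <= b / 2, so dividing
   by l^g costs at most half of the exponent in s^b = exp(b l). The [g + 1] keeps the denominator
   positive when [alpha] is 0. *)
pose d := b / (2 * (g + 1)).
have g10 : 0 < g + 1 by rewrite ltr_wpDl.
have d0 : 0 < d by rewrite divr_gt0// mulr_gt0.
(* The surviving factor exp(b l / 2) is at least b l / 2, which is at least p0 d^(-g) / c as soon as
   l >= [l0]. *)
pose l0 := p0 * 2 / (b * c * d `^ g).
exists (expR (Num.max 1 l0)); first exact: expR_gt0.
move=> s Ts; set p := c * _.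
have s0 : 0 < s by rewrite (lt_le_trans _ Ts)// expR_gt0.
have Tl : Num.max 1 l0 <= ln s by rewrite -ler_expR lnK.
have : 1 <= ln s by rewrite (le_trans _ Tl)// le_max lexx.
have : l0 <= ln s by rewrite (le_trans _ Tl)// le_max lexx orbT.
set l := ln s => ll0 l1.
have lp : 0 < l by rewrite (lt_le_trans _ l1).
have sE e : s `^ e = expR (e * l) by rewrite /powR gt_eqF.
have lg1 : 1 <= l `^ g.
  by rewrite -(powRr0 l) ler_powR.
have lg0 : 0 < l `^ g by rewrite powR_gt0.
have p_le : p <= s `^ b.
  rewrite /p -/g -/b -[leRHS]mul1r ler_pM ?(ltW c0)// ?divr_ge0 ?powR_ge0//.
  by rewrite ler_pdivrMr// ler_peMr// powR_ge0.
have pp0 : p0 <= p.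
  rewrite /p -/g -/b mulrC -ler_pdivrMr// ler_pdivlMr//.
  have ldl : l `^ g <= d `^ (- g) * expR (b * l / 2).
    have : l <= d^-1 * expR (d * l).
      rewrite -ler_pdivrMl ?invr_gt0// invrK.
      by rewrite (le_trans _ (expR_ge1Dx _))// lerDr.
    move=> lle.
    have dl0 : 0 <= d^-1 * expR (d * l).
      by rewrite mulr_ge0 ?expR_ge0// invr_ge0 ltW.
    rewrite (le_trans (ge0_ler_powR g0 _ _ lle)) ?nnegrE ?(ltW lp)//.
    rewrite powRM ?expR_ge0// ?invr_ge0 ?(ltW d0)//.
    rewrite -[d^-1]powR_inv1 ?(ltW d0)// -powRrM mulN1r ler_pM2l ?powR_gt0//.
    rewrite /powR gt_eqF ?expR_gt0// expRK ler_expR.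
    have dg : d * g <= b / 2.
      rewrite /d invfM -mulrA -mulrA ler_pM2l// ler_piMr ?invr_ge0//.
      by rewrite mulrC ler_pdivrMr// mul1r lerDl.
    by rewrite mulrA [g * d]mulrC [b * l / 2]mulrAC ler_pM2r.
  apply: (le_trans (ler_wpM2l _ ldl)); first by rewrite divr_ge0 ?ltW// (lt_trans _ p01).
  rewrite sE.
  rewrite [b * l in leRHS]splitr expRD mulrA ler_pM2r ?expR_gt0//.
  have : p0 / c * d `^ (- g) <= b * l / 2.
    move: ll0; rewrite /l0 ler_pdivrMr ?mulr_gt0 ?powR_gt0//.
    rewrite powRN !ler_pdivrMr ?powR_gt0//.
    have -> : b * l / 2 * d `^ g * c = l * (b * c * d `^ g) / 2 by ring.
    by rewrite ler_pdivlMr.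
  move=> /le_trans; apply; rewrite (le_trans _ (expR_ge1Dx _))//.
  by rewrite lerDr.
split=> //.
have p1 : 1 < p by exact: lt_le_trans pp0.
have lnp : ln p <= b * l.
  have : ln p <= ln (s `^ b) by rewrite ler_ln ?posrE ?powR_gt0// (lt_trans _ p1).
  by rewrite ln_powR.
have lnp0 : 0 <= ln p by rewrite ln_ge0// ltW.
have lna : ln p `^ alpha <= b `^ alpha * l `^ alpha.
  rewrite -powRM ?(ltW bp)// ?(ltW lp)//.
  by apply: ge0_ler_powR; rewrite ?nnegrE// mulr_ge0 ?ltW.
have pb : p `^ beta = c `^ beta * (s / l `^ alpha).
  rewrite /p -/g powRM ?(ltW c0)// ?divr_ge0 ?powR_ge0//; congr (_ * _).
  rewrite powRM ?powR_ge0// ?invr_ge0 ?powR_ge0//.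
  rewrite -powRrM mulVf ?gt_eqF// powRr1 ?(ltW s0)//; congr (_ * _).
  rewrite -[(l `^ g)^-1]powR_inv1 ?powR_ge0// -!powRrM.
  by rewrite mulN1r mulrN /g divfK ?gt_eqF// powRN.
rewrite pb.
apply: (@le_trans _ _ (2 * (q * (s / l `^ alpha) * (b `^ alpha * l `^ alpha)))).
  rewrite ler_pM2l// ler_pM ?powR_ge0//.
    by rewrite !mulr_ge0 ?powR_ge0 ?invr_ge0 ?powR_ge0// ltW.
  by rewrite ler_wpM2r// divr_ge0 ?powR_ge0// ltW.
rewrite le_eqVlt; apply/orP; left; apply/eqP.
have lA : l `^ alpha != 0 by rewrite gt_eqF// powR_gt0.
have bA : beta `^ alpha != 0 by rewrite gt_eqF// powR_gt0.
have -> : b `^ alpha = (beta `^ alpha)^-1.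
  by rewrite /b -[beta^-1]powR_inv1 ?ltW// -powRrM mulN1r powRN.
rewrite /q.
rewrite -[_ * (_ / _) * _]mulrA -[s / _ * _]mulrA [_^-1 * (_ * _)]mulrCA mulVf// mulr1.
by field.
Qed.

(** * Hilbert space operators and the double commutant *)

Lemma norm_real_complex (R : realType) (r : R) : `|r%:C| = `|r|%:C :> R[i].
Proof. by rewrite normc_def/= expr0n addr0 sqrtr_sqr. Qed.

Lemma nrmE (R : realType) (V : normedModType R[i]) (x : V) :
  `|x| = (nrm x)%:C :> R[i].
Proof. by rewrite /nrm RRe_real// normr_real. Qed.

Lemma nrm_ge0 (R : realType) (V : normedModType R[i]) (x : V) : 0 <= nrm x.
Proof. by rewrite -ler0c -nrmE. Qed.

Section bounded_linear_maps.
Variables (R : realType) (V W : normedModType R[i]).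

Lemma linear_bound_continuous (f : V -> W) (C : R) : linear f ->
  (forall x, `|f x| <= C%:C * `|x|) -> continuous f.
Proof.
move=> lf fC.
pose g : {linear V -> W} := HB.pack f (GRing.isLinear.Build _ _ _ _ _ lf).
suff: continuous g by [].
apply/linear_bounded_continuous/linear_boundedP.
near=> r => x; apply: le_trans (fC x) _.
rewrite ler_wpM2r//; near: r; apply: nbhs_pinfty_ge.
by rewrite complex_real.
Unshelve. all: by end_near. Qed.

Lemma continuous_linear_bound (f : V -> W) : linear f -> continuous f ->
  exists2 C : R, 0 < C & forall x, nrm (f x) <= C * nrm x.
Proof.
move=> lf cf.
pose g : {linear V -> W} := HB.pack f (GRing.isLinear.Build _ _ _ _ _ lf).
have : bounded_near g (nbhs 0) by exact/linear_bounded_continuous.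
move=> /linear_boundedP /pinfty_ex_gt0 [C C0 gC].
have CE : C = (complex.Re C)%:C by rewrite RRe_real// gtr0_real.
exists (complex.Re C); first by rewrite -ltcR -CE.
by move=> x; rewrite -lecR rmorphM/= -CE -!nrmE; exact: gC.
Qed.

End bounded_linear_maps.

Section von_Neumann_algebra_facts.
Variables (R : realType) (H : completeNormedModType R[i]).
Variable dot : {dot H for @Num.conj R[i]}.
Hypothesis hH : hilbert_norm dot.

Lemma dot_conj x y : dot x y = Num.conj (dot y x).
Proof. by rewrite hermC /= expr0 mul1r. Qed.

Lemma dot_nrm x : dot x x = (nrm x ^+ 2)%:C.
Proof. by rewrite -hH nrmE rmorphXn. Qed.

Lemma dotBl x y z : dot (x - y) z = dot x z - dot y z.
Proof. exact: linearBl. Qed.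

Lemma dotDl x y z : dot (x + y) z = dot x z + dot y z.
Proof. exact: linearDl. Qed.

Lemma dotZl a x z : dot (a *: x) z = a * dot x z.
Proof. exact: linearZl_LR. Qed.

(* [CauchySchwarz] in the library is restricted to finite dimension. *)
Lemma dot_CauchySchwarz x y : `|dot x y| <= `|x| * `|y|.
Proof.
have [->|y0] := eqVneq y 0; first by rewrite linear0r !normr0 mulr0.
have yy0 : 0 < dot y y by rewrite dnorm_gt0.
pose u := dot y y *: x - dot x y *: y.
have uy : dot u y = 0 by rewrite dotBl !dotZl mulrC subrr.
have : 0 <= dot u u by exact: dnorm_ge0.
rewrite {2}/u linearBr/= !linearZr_LR/= uy mulr0 subr0.
have -> : dot u x = dot y y * dot x x - `|dot x y| ^+ 2.
  by rewrite dotBl !dotZl normCK -dot_conj.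
rewrite /= conj_Creal ?gtr0_real// pmulr_rge0// subr_ge0 -!hH -exprMn.
by rewrite ler_pXn2r ?nnegrE ?mulr_ge0// mulrC.
Qed.

Lemma dot_cvgl (u : nat -> H) (l x : H) :
  u @ \oo --> l -> (fun n => dot (u n) x) @ \oo --> (dot l x : R[i]^o).
Proof.
move=> ul.
have lf : linear (fun y : H => dot y x : R[i]^o).
  by move=> a y z; rewrite dotDl dotZl.
have cf : continuous (fun y : H => dot y x : R[i]^o).
  apply: (@linear_bound_continuous _ _ (R[i]^o) _ (nrm x) lf) => y.
  by rewrite -nrmE mulrC; exact: dot_CauchySchwarz.
exact: (cvg_comp _ _ ul (cf l)).
Qed.

Lemma bounded_op0 : bounded_op (0 : H -> H).
Proof.
split; first by move=> a x y /=; rewrite scaler0 addr0.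
exact: cst_continuous.
Qed.

Section commutants.
Variable A : set (H -> H).
Hypothesis linA : forall a, A a -> bounded_op a.

Lemma commutant0 : commutant A 0.
Proof.
split; first exact: bounded_op0.
move=> a /linA [la _]; apply/funext => x /=.
by have := la (-1) 0 0; rewrite scaler0 addr0 scaleN1r addNr.
Qed.

Lemma commutantP k a b : commutant A a -> commutant A b ->
  commutant A (k *: a + b).
Proof.
move=> [[la ca] caA] [[lb cb] cbA]; split; first split.
- move=> l x y /=; rewrite /= !fctE.
  by rewrite la lb !scalerDr !scalerA [l * k]mulrC addrACA.
- by move=> x; apply: continuousD; [apply: continuousZl_tmp; exact: ca|exact: cb].
move=> c Ac; apply/funext => x /=; rewrite !fctE /=.
have [lc _] := linA Ac.
have := congr1 (@^~ x) (caA c Ac); have := congr1 (@^~ x) (cbA c Ac) => /= <- <-.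
by rewrite lc.
Qed.

(** Pass to the limit in a (u_n x) = u_n (a x), using the continuity of [a] on the left. *)
Lemma commutant_lim (u : nat -> H -> H) (b : H -> H) : 
  (forall n, commutant A (u n)) -> bounded_op b ->
  (forall x, (fun n => u n x) @ \oo --> b x) -> commutant A b.
Proof.
move=> cu bb ub; split => // a Aa; apply/funext => x /=.
have [_ ca] := linA Aa.
have h1 : (fun n => a (u n x)) @ \oo --> a (b x).
  by apply: continuous_cvg; [exact: ca|exact: ub].
have h2 : (fun n => a (u n x)) @ \oo --> b (a x).
  rewrite (_ : (fun n => _) = (fun n => u n (a x))); first exact: ub.
  apply/funext => n; have [_ /(_ a Aa) /(congr1 (@^~ x))] := cu n; exact.
exact: (cvg_unique _ h1 h2).
Qed.

End commutants.

Section von_Neumann_closure.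
Variable M : set (H -> H).
Hypothesis hM : von_Neumann dot M.

(** [M] is the commutant of [commutant M], so the closure properties of commutants apply with
    [A := commutant M]; this fact discharges their hypothesis [linA]. *)
Let commM a : commutant M a -> bounded_op a. Proof. by case. Qed.

Lemma von_Neumann_bounded a : M a -> bounded_op a.
Proof. by rewrite -hM.2 => -[]. Qed.

Lemma von_Neumann0 : M 0.
Proof. by rewrite -hM.2; exact: commutant0. Qed.

Lemma von_NeumannP k a b : M a -> M b -> M (k *: a + b).
Proof. by rewrite -hM.2; exact: commutantP. Qed.

Lemma von_NeumannB a b : M a -> M b -> M (a - b).
Proof.
by move=> Ma Mb; rewrite addrC -scaleN1r; exact: von_NeumannP.
Qed.

Lemma von_Neumann_lim (u : nat -> H -> H) (b : H -> H) :
  (forall n, M (u n)) -> bounded_op b ->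
  (forall x, (fun n => u n x) @ \oo --> b x) -> M b.
Proof. by rewrite -hM.2; exact: commutant_lim. Qed.

End von_Neumann_closure.
End von_Neumann_algebra_facts.

(** * Integrals of bounded functions through binary digits *)

Section binary_expansion.
Context {d : measure_display} {T : measurableType d} {R : realType}.
Variables (f : T -> R) (N : R).
Hypothesis mf : measurable_fun setT f.
Hypothesis fN : forall s, 0 <= f s <= N.

(** Greedy extraction of digits: the remainder [r n] stays between 0 and N / 2^n, because half of
    that bound is subtracted exactly where the remainder reaches the half. *)
Lemma binary_expansion : exists2 B : nat -> set T,
  forall k, measurable (B k) &
  forall n s, 0 <= f s - \sum_(k < n) N / 2 ^+ k.+1 * \1_(B k) s <= N / 2 ^+ n.
Proof.
pose next k (g : T -> R) := fun s =>
  g s - N / 2 ^+ k.+1 * \1_[set s | N / 2 ^+ k.+1 <= g s] s.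
pose r := fix r n := if n is k.+1 then next k (r k) else f.
pose B k := [set s | N / 2 ^+ k.+1 <= r k s].
have mB k : measurable_fun setT (r k) -> measurable (B k).
  by move=> mr; rewrite -[B k]setTI; apply: measurable_fun_le.
have mr k : measurable_fun setT (r k).
  elim: k => [|k IH]//=; apply: measurable_funB => //.
  by apply: measurable_funM => //; apply: measurable_indic; exact: mB.
exists B; first by move=> k; exact: mB.
move=> n s.
have -> : f s - \sum_(k < n) N / 2 ^+ k.+1 * \1_(B k) s = r n s.
  elim: n => [|n IH]; first by rewrite big_ord0 subr0.
  by rewrite big_ord_recr/= /next -IH opprD addrA.
elim: n => [|n /andP[IH0 IH1]]; first by rewrite expr0 divr1.
rewrite /= /next indicE.
have N2 : N / 2 ^+ n = N / 2 ^+ n.+1 + N / 2 ^+ n.+1.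
  by rewrite exprS invfM mulrCA -mulrDl; field; rewrite expf_neq0.
have [h|h] := boolP (N / 2 ^+ n.+1 <= r n s).
  by rewrite mem_set// mulr1 subr_ge0 h/= lerBlDr -N2.
rewrite memNset; last exact/negP.
by rewrite mulr0 subr0 IH0/= ltW// ltNge.
Qed.

End binary_expansion.

Section integral_binary_expansion.
Context {d : measure_display} {T : measurableType d} {R : realType}.
Variables (mu : {measure set T -> \bar R}).
Hypothesis muT : (mu setT < +oo)%E.

Lemma bounded_integrable (g : T -> R) (C : R) : measurable_fun setT g ->
  (forall s, `|g s| <= C) -> mu.-integrable setT (EFin \o g).
Proof.
move=> mg gC; apply: measurable_bounded_integrable => //.
exists C; split; first exact: num_real.
by move=> x Cx s _; exact: le_trans (gC s) (ltW Cx).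
Qed.

Lemma Rintegral_indic (A : set T) : measurable A ->
  \int[mu]_(s in setT) \1_A s = fine (mu A).
Proof. by move=> mA; rewrite /Rintegral integral_indic// setIT. Qed.

(** By linearity over the indicators of the [B k], the error is the integral of a function with
    values in [0, N / 2^n]. *)
Lemma Rintegral_binary_expansion (f : T -> R) (N : R) (B : nat -> set T) n :
  0 <= N -> measurable_fun setT f -> (forall s, 0 <= f s <= N) ->
  (forall k, measurable (B k)) ->
  (forall s, 0 <= f s - \sum_(k < n) N / 2 ^+ k.+1 * \1_(B k) s <= N / 2 ^+ n) ->
  `|\int[mu]_(s in setT) f s - \sum_(k < n) N / 2 ^+ k.+1 * fine (mu (B k))| <=
  N / 2 ^+ n * fine (mu setT).
Proof.
move=> N0 mf fN mB fB.
have iI k : mu.-integrable setT (EFin \o (\1_(B k) : T -> R)).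
  apply: (@bounded_integrable _ 1) => [|s].
    exact: measurable_indic.
  by rewrite indicE; case: (_ \in _); rewrite ?normr1 ?normr0.
have intf : mu.-integrable setT (EFin \o f).
  apply: (@bounded_integrable _ N) => // s.
  by have /andP[f0 ?] := fN s; rewrite ger0_norm.
pose g m (s : T) := \sum_(k < m) N / 2 ^+ k.+1 * \1_(B k) s.
have ig m : mu.-integrable setT (EFin \o g m) /\
    \int[mu]_(s in setT) g m s = \sum_(k < m) N / 2 ^+ k.+1 * fine (mu (B k)).
  elim: m => [|m [IH1 IH2]].
    have -> : g 0 = cst 0 by apply/funext => s; rewrite /g big_ord0.
    split; last by rewrite Rintegral_cst// mul0r big_ord0.
    by apply: (@bounded_integrable _ 0) => // s; rewrite normr0.
  have -> : g m.+1 = fun s => g m s + N / 2 ^+ m.+1 * \1_(B m) s.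
    by apply/funext => s; rewrite /g big_ord_recr.
  have iZ : mu.-integrable setT (EFin \o (fun s => N / 2 ^+ m.+1 * \1_(B m) s)).
    apply: (@bounded_integrable _ (N / 2 ^+ m.+1)) => [|s].
      by apply: measurable_funM => //; exact: measurable_indic.
    have w0 : 0 <= N / 2 ^+ m.+1 by rewrite divr_ge0// exprn_ge0.
    by rewrite indicE ger0_norm ?mulr_ge0// ler_piMr// lern1; case: (_ \in _).
  split.
    by apply: eq_integrable (integrableD measurableT IH1 iZ) => // s _; rewrite /= EFinD.
  by rewrite RintegralD// RintegralZl// IH2 Rintegral_indic// big_ord_recr.
have [ign <-] := ig n.
rewrite -RintegralB// ger0_norm; last first.
  by apply: Rintegral_ge0 => s _; have /andP[] := fB s.
rewrite -Rintegral_cst//; apply: le_Rintegral => //.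
- by apply: eq_integrable (integrableB measurableT intf ign) => // s _; rewrite /= EFinB.
- by apply: (@bounded_integrable _ `|N / 2 ^+ n|).
- by move=> s _; have /andP[] := fB s.
Qed.

End integral_binary_expansion.

(** * Spectral calculus *)

Lemma near_geometric_half (R : realType) (c : R) (e : R[i]) : 0 < e ->
  \forall n \near \oo, (c / 2 ^+ n)%:C < e.
Proof.
move=> e0.
(* Positivity in [R[i]] forces [e] to be real, so the comparison can be made in [R]. *)
have eE : e = (complex.Re e)%:C by rewrite RRe_real// gtr0_real.
have re0 : 0 < complex.Re e by rewrite -ltcR -eE.
have /cvgrPdist_lt /(_ _ re0) : geometric c (2^-1) @ \oo --> (0 : R^o).
  by apply: cvg_geometric; rewrite ger0_norm// invf_lt1// ltr1n.
apply: filterS => n /=; rewrite sub0r normrN exprVn => h.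
by rewrite eE ltcR (le_lt_trans _ h)// ler_norm.
Qed.

Section spectral_calculus.
Variables (R : realType) (H : completeNormedModType R[i]).
Variable dot : {dot H for @Num.conj R[i]}.
Hypothesis hH : hilbert_norm dot.
Variable M : set (H -> H).
Hypothesis hM : von_Neumann dot M.
Variable E : set R -> H -> H.
Hypothesis pvm : projection_valued_measure dot M E.

Lemma nrm_eq0 (x : H) : nrm x = 0 -> x = 0.
Proof. by move=> x0; apply/normr0_eq0; rewrite nrmE x0. Qed.

Lemma pvm_idem B x : measurable B -> E B (E B x) = E B x.
Proof.
by move=> mB; have := pvm_setI pvm mB mB; rewrite setIid => /(congr1 (@^~ x)).
Qed.

Lemma pvm_dot B x : measurable B -> dot (E B x) x = (nrm (E B x) ^+ 2)%:C.
Proof.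
by move=> mB; rewrite -(dot_nrm hH) -(pvm_self_adjoint pvm mB) pvm_idem.
Qed.

Lemma pvm_nrm_le B x : measurable B -> nrm (E B x) <= nrm x.
Proof.
move=> mB; have [->|Ex0] := eqVneq (nrm (E B x)) 0; first exact: nrm_ge0.
have := dot_CauchySchwarz hH (E B x) x.
rewrite pvm_dot// norm_real_complex !nrmE -rmorphM lecR.
rewrite ger0_norm ?sqr_ge0// expr2 ler_pM2l// lt_def Ex0.
exact: nrm_ge0.
Qed.

Lemma pvm_set0 x : E set0 x = 0.
Proof.
have [mu muE] := pvm_sigma_additive pvm x.
have := muE _ measurable0; rewrite measure0 pvm_dot//= => -[] /esym/eqP.
by rewrite sqrf_eq0 => /eqP /nrm_eq0.
Qed.

Lemma pvm_dot_measure (mu : {measure set R -> \bar R}) x :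
  (forall B, measurable B -> mu B = (complex.Re (dot (E B x) x))%:E) ->
  forall B, measurable B -> mu B = (nrm (E B x) ^+ 2)%:E.
Proof. by move=> muE B mB; rewrite muE// pvm_dot. Qed.

(* On the range of E(]2C, oo[) one would have <h y, y> >= 2C |y|^2. *)
Lemma pvm_tail (h : H -> H) (C : R) : 0 < C ->
  (forall x, nrm (h x) <= C * nrm x) -> is_spectral_integral dot E id h ->
  forall x, E `]2 * C, +oo[ x = 0.
Proof.
move=> C0 hC hE x; set B : set R := `]2 * C, +oo[%classic.
have mB : measurable B by exact: measurable_itv.
pose y := E B x; rewrite -/y.
have [mu [/pvm_dot_measure muE iid hy]] := hE y.
(* [y] lies in the range of E(B), so its scalar measure charges only [B], where the integrand
   exceeds 2C. *)
have muNB : mu (~` B) = 0%E.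
  have mC := measurableC mB.
  rewrite muE// /y.
  have /(congr1 (@^~ x)) /= <- := pvm_setI pvm mC mB.
  rewrite setICl pvm_set0.
  by rewrite /nrm normr0/= expr0n.
have muB : mu B = (nrm y ^+ 2)%:E by rewrite muE// /y pvm_idem.
have int_ge : 2 * C * nrm y ^+ 2 <= \int[mu]_(s in setT) s.
  rewrite /Rintegral (negligible_integral (measurableC mB) measurableT)//.
  rewrite setTD setCK.
  have -> : 2 * C * nrm y ^+ 2 = \int[mu]_(s in B) (2 * C).
    by rewrite Rintegral_cst// muB.
  apply: le_Rintegral => //.
  - apply: measurable_bounded_integrable => //; first by rewrite muB ltry.
    exists (2 * C); split; first exact: num_real.
    by move=> z Cz s _ /=; rewrite ger0_norm ?ltW// mulr_gt0.
  - by apply: integrableS iid.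
  - by move=> s; rewrite /B/= in_itv/= andbT => /ltW.
(* Cauchy-Schwarz gives the upper bound C |y|^2; against 2C |y|^2 from below it forces [y] to
   vanish. *)
have int_le : \int[mu]_(s in setT) s <= C * nrm y ^+ 2.
  have := dot_CauchySchwarz hH (h y) y.
  rewrite hy norm_real_complex !nrmE -rmorphM lecR.
  move=> h1; apply: le_trans (ler_norm _) (le_trans h1 _).
  by rewrite expr2 mulrA ler_wpM2r ?nrm_ge0.
have := le_trans int_ge int_le.
rewrite -mulrA mulr_natl mulr2n gerDl pmulr_rle0// => y2.
by apply: nrm_eq0; apply/eqP; rewrite -sqrf_eq0 eq_le y2 sqr_ge0.
Qed.

Lemma spectral_integral_bounded (g : R -> R) (N : R) : 0 <= N ->
  measurable_fun setT g -> (forall s, 0 <= g s <= N) ->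
  exists2 b, M b & is_spectral_integral dot E g b.
Proof.
move=> N0 mg gN.
have [B mB gB] := binary_expansion mg gN.
pose w k : R := N / 2 ^+ k.+1.
have w0 k : 0 <= w k by rewrite divr_ge0// exprn_ge0.
have wE k : w k = N / 2 ^+ k - N / 2 ^+ k.+1.
  by rewrite /w exprS; field; rewrite expf_neq0.
pose v x k := (w k)%:C *: E (B k) x.
pose u n x := \sum_(0 <= k < n) v x k.
have Mu n : M (u n).
  elim: n => [|n IH].
    have -> : u 0 = 0 by apply/funext => x; rewrite /u big_geq.
    exact: (von_Neumann0 hM).
  have -> : u n.+1 = (w n)%:C *: E (B n) + u n.
    by apply/funext => x; rewrite /u big_nat_recr//= addrC.
  by apply: (von_NeumannP hM) => //; exact: (pvm_in pvm).
(* Since |E(B_k) x| <= |x|, the sum is dominated by the weights [w k], which telescope by [wE]. *)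
have tail x n i :
    `|\sum_(n <= k < n + i) v x k| <= ((N / 2 ^+ n - N / 2 ^+ (n + i)) * nrm x)%:C.
  elim: i => [|i IH]; first by rewrite addn0 big_geq// subrr mul0r normr0.
  rewrite addnS big_nat_recr ?leq_addr//= (le_trans (ler_normD _ _))//.
  rewrite (le_trans (lerD IH (_ : _ <= (w (n + i) * nrm x)%:C)))//.
    rewrite /v normrZ norm_real_complex ger0_norm//.
    by rewrite nrmE -rmorphM lecR ler_wpM2l// pvm_nrm_le.
  by rewrite -rmorphD/= -mulrDl wE addrA subrK.
have tail' x n m : (n <= m)%N -> `|\sum_(n <= k < m) v x k| <= (N * nrm x / 2 ^+ n)%:C.
  move=> /subnKC <-; rewrite (le_trans (tail _ _ _))// lecR mulrAC.
  by rewrite ler_wpM2r ?nrm_ge0// gerBl divr_ge0// exprn_ge0.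
have cvgu x : cvgn (u ^~ x).
  apply/cauchy_cvgP/cauchy_seriesP => e e0.
  (* The bound in [tail'] depends on the lower index alone, so only [n] has to be large. *)
  exists ([set n | (N * nrm x / 2 ^+ n)%:C < e], setT); first split => /=.
  - exact: near_geometric_half.
  - exact: filterT.
  move=> [n m] [/= ne _]; have [nm|mn] := leqP n m.
    by rewrite (le_lt_trans (tail' _ _ _ nm)).
  by rewrite big_geq ?normr0// ltnW.
pose b x := lim (u ^~ x @ \oo).
have ub x : u ^~ x @ \oo --> b x by exact: cvgu.
have linb : linear b.
  move=> a x y.
  have h1 : (fun n => u n (a *: x + y)) @ \oo --> a *: b x + b y.
    rewrite (_ : (fun n => _) = (fun n => a *: u n x + u n y)).
      by apply: cvgD; [apply: cvgZl_tmp; exact: ub|exact: ub].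
    by apply/funext => n; have [/(_ a x y)] := von_Neumann_bounded hM (Mu n).
  exact: (cvg_unique _ (ub _) h1).
(* Every partial sum is bounded by N |x|, and the limit inherits this up to an arbitrary [e]. It
   gives the boundedness that [von_Neumann_lim] asks for. *)
have bN x : `|b x| <= N%:C * `|x|.
  apply/ler_addgt0Pr => e e0.
  have /cvgrPdist_lt /(_ _ e0) [n _ /(_ n (leqnn n)) /= une] := ub x.
  rewrite -[b x](subrK (u n x)) (le_trans (ler_normD _ _))// addrC lerD//.
    by rewrite (le_trans (tail' _ _ _ (leq0n n)))// expr0 divr1 rmorphM/= -nrmE.
  exact: ltW.
have Mb : M b.
  apply: (von_Neumann_lim hM Mu _ ub); split => //.
  exact: linear_bound_continuous linb bN.
exists b => // x.
have [mu muE] := pvm_sigma_additive pvm x.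
have muE' := pvm_dot_measure muE.
have muT : (mu setT < +oo)%E by rewrite muE ?ltry.
exists mu; split => //.
  apply: (bounded_integrable muT mg (C := N)) => s.
  by have /andP[? ?] := gN s; rewrite ger0_norm.
have dotu n : dot (u n x) x = (\sum_(k < n) w k * fine (mu (B k)))%:C.
  elim: n => [|n IH]; first by rewrite /u big_geq// linear0l big_ord0.
  rewrite /u big_nat_recr//= dotDl -/(u n x) IH dotZl pvm_dot// -rmorphM -rmorphD.
  by rewrite big_ord_recr/= muE'.
(* <b x, x> is the limit of <u_n x, x> by continuity of the form; once the integral is a limit of
   the same sequence, the two agree. *)
suff hl : (fun n => dot (u n x) x) @ \oo -->
    ((\int[mu]_(s in setT) g s)%:C : R[i]^o).
  exact: (@cvg_unique _ (@norm_hausdorff _ R[i]^o) _ _ _ _ (dot_cvgl hH (ub x)) hl).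
apply/cvgrPdist_lt => e e0.
near=> n; rewrite dotu -rmorphB norm_real_complex.
apply: (@le_lt_trans _ _ (N * fine (mu setT) / 2 ^+ n)%:C).
  by rewrite lecR mulrAC; exact: Rintegral_binary_expansion.
by near: n; exact: near_geometric_half.
Unshelve. all: by end_near. Qed.

(** [g] may be unbounded, but [E] vanishes on ]2C, oo[ by [pvm_tail], so [g] can be cut off there
    without changing its integrals. The cut is on the right only, so [g] must be bounded on every
    half-line ]-oo, C]. *)
Lemma spectral_integral_exists (h : H -> H) (g : R -> R) : M h ->
  is_spectral_integral dot E id h -> measurable_fun setT g ->
  (forall s, 0 <= g s) ->
  (forall C, exists N, forall s, s <= C -> g s <= N) ->
  exists2 b, M b & is_spectral_integral dot E g b.
Proof.
move=> Mh hE mg g0 gN.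
have [lh ch] := von_Neumann_bounded hM Mh.
have [C C0 hC] := continuous_linear_bound lh ch.
have E0 := pvm_tail C0 hC hE.
have [N hN] := gN (2 * C).
have N0 : 0 <= N by exact: le_trans (g0 _) (hN _ (lexx _)).
pose A : set R := `]-oo, 2 * C]%classic.
have mA : measurable A by exact: measurable_itv.
pose g' s := g s * \1_A s.
have g'A s : A s -> g' s = g s by move=> As; rewrite /g' indicE mem_set// mulr1.
have g'N s : 0 <= g' s <= N.
  rewrite /g' indicE; have [As|nAs] := boolP (s \in A).
    by rewrite mulr1 g0 hN//; move: As; rewrite inE /A/= in_itv.
  by rewrite mulr0 lexx.
have mg' : measurable_fun setT g'.
  by apply: measurable_funM => //; exact: measurable_indic.
have [b Mb bE] := spectral_integral_bounded N0 mg' g'N.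
exists b => // x; have [mu [muE ig' bx]] := bE x.
have muE' := pvm_dot_measure muE.
have muA : mu (~` A) = 0%E.
  rewrite /A setCitvl muE'; last exact: measurable_itv.
  by rewrite E0 /nrm normr0/= expr0n.
have mCA := measurableC mA.
have DA : setT `\` ~` A = A by rewrite setTD setCK.
have gg' : {in A, EFin \o g' =1 EFin \o g}.
  by move=> s; rewrite inE => As /=; rewrite g'A.
have ig : mu.-integrable setT (EFin \o g).
  apply/(negligible_integrable mCA measurableT _ muA); first exact/measurable_EFinP.
  rewrite DA; apply: eq_integrable gg' _ => //.
  by apply: integrableS ig'.
exists mu; split => //; rewrite bx; congr (fine _)%:C.
rewrite (negligible_integral mCA measurableT ig' muA).
rewrite [RHS](negligible_integral mCA measurableT ig muA) DA.
exact: eq_integral.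
Qed.

End spectral_calculus.

(** * The complex interpolation norm *)

Lemma nrmZ (R : realType) (V : normedModType R[i]) (a : R[i]) (y : V) :
  nrm (a *: y) = complex.Re `|a| * nrm y.
Proof. by rewrite /nrm normrZ (nrmE y) normc_def -rmorphM. Qed.

Section interpolation_bound.
Variables (R : realType) (theta : R).

(* On the closed strip Re (z^2) <= 1 - (Im z)^2, which keeps the denominator
   away from 0. *)
Definition peak_den (z : R[i]^o) : R[i]^o :=
  1 - 2^-1 * (z * z - (theta ^+ 2)%:C).

(** The scalar factor of the test function: it equals 1 at [theta], and its bound 2 / (1 + y^2) on
    the strip supplies both the constant 2 and the decay at the two ends. *)
Definition peak (z : R[i]^o) : R[i]^o := (peak_den z)^-1.

Lemma Re_peak_den x y : complex.Re (peak_den (x +i* y)) =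
  1 - 2^-1 * (x ^+ 2 - y ^+ 2 - theta ^+ 2).
Proof.
rewrite /peak_den.
have -> : (2^-1 : R[i]) = (2^-1)%:C by rewrite fmorphV rmorph_nat.
by simpc => /=; rewrite !expr2.
Qed.

Lemma peak_den_ge x y : 0 <= x <= 1 ->
  (1 + y ^+ 2) / 2 <= complex.Re (peak_den (x +i* y)).
Proof.
move=> /andP[x0 x1]; rewrite Re_peak_den.
have : x ^+ 2 <= 1 by rewrite expr_le1.
(* The term theta^2 only increases the real part, so the bound is uniform in [theta]. *)
have := sqr_ge0 theta; lra.
Qed.

Lemma peak_le x y : 0 <= x <= 1 ->
  complex.Re `|peak (x +i* y)| <= 2 / (1 + y ^+ 2).
Proof.
move=> x01; have := peak_den_ge y x01.
have y0 : 0 < 1 + y ^+ 2 by rewrite ltr_pwDl// sqr_ge0.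
move=> h; rewrite /peak normfV.
set z := peak_den _ in h *.
have zh : (1 + y ^+ 2) / 2 <= complex.Re `|z|.
  rewrite (le_trans h)// -lecR (RRe_real (normr_real z)).
  by rewrite (le_trans _ (normc_ge_Re z))// lecR ler_norm.
have zE : `|z| = (complex.Re `|z|)%:C by rewrite RRe_real ?normr_real.
rewrite zE -fmorphV/= -[2 / _]invf_div lef_pV2// posrE ?divr_gt0//.
by rewrite (lt_le_trans _ zh)// divr_gt0.
Qed.

Lemma peak_den_neq0 z : closed_strip z -> peak_den z != 0.
Proof.
case: z => x y /(peak_den_ge y) h; apply/eqP => h0; move: h.
by rewrite h0/= leNgt divr_gt0// ltr_pwDl// sqr_ge0.
Qed.

Lemma derivable_peak z : closed_strip z -> derivable peak z 1.
Proof.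
by move=> /peak_den_neq0 z0; exact: derivableV.
Qed.

Lemma continuous_peak z : closed_strip z -> {for z, continuous peak}.
Proof.
move=> /derivable_peak h; apply: differentiable_continuous.
exact/derivable1_diffP.
Qed.

Lemma continuous_peakZ (V : normedModType R[i]) (v : V) z : closed_strip z ->
  {for z, continuous (fun z => peak z *: v)}.
Proof.
move=> hz.
exact: (@cvgZr_tmp _ _ _ (nbhs z) _ peak (peak z) v (continuous_peak hz)).
Qed.

Lemma derivable_peakZ (V : normedModType R[i]) (v : V) z : closed_strip z ->
  derivable (fun z => peak z *: v) z 1.
Proof.
move=> /derivable_peak; rewrite /derivable => /(@is_cvgZr_tmp _ _ _ _ _ _ v).
(* The difference quotient of the product is that of [peak] times [v], so its convergence is
   inherited. *)
set q := fun _ => _; set q' := (X in _ -> cvg (X @ _)); suff -> : q = q' by [].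
apply/funext => h; rewrite /q /q'/= -scalerBl scalerA.
by [].
Qed.

Lemma peak_theta : peak theta%:C = 1.
Proof. by rewrite /peak /peak_den -rmorphM -expr2 subrr mulr0 subr0 invr1. Qed.

Lemma continuous_peak_line x : 0 <= x <= 1 ->
  continuous (fun t : R => peak (x +i* t)).
Proof.
move=> x01 t; apply: (@continuous_comp _ _ _ (fun t : R => (x +i* t : R[i]^o)) peak).
  apply/cvgrPdist_lt => e e0.
  have eE : e = (complex.Re e)%:C by rewrite RRe_real// gtr0_real.
  have re0 : 0 < complex.Re e by rewrite -ltcR -eE.
  apply: filterS (nbhsx_ballx t _ re0) => s /= ts.
  have -> : x +i* t - (x +i* s) = 0 +i* (t - s) :> R[i].
    by apply/eqP; rewrite eq_complex/= subrr !eqxx.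
  by rewrite normc_def/= expr0n add0r sqrtr_sqr eE ltcR.
exact: continuous_peak.
Qed.

Lemma nrm_peak_le (V : normedModType R[i]) (v : V) z : closed_strip z ->
  nrm (peak z *: v) <= 2 * nrm v.
Proof.
case: z => x y xy; rewrite nrmZ ler_wpM2r ?nrm_ge0// (le_trans (peak_le _ xy))//.
have y0 : 0 < 1 + y ^+ 2 by rewrite ltr_pwDl// sqr_ge0.
by rewrite ler_pdivrMr// ler_peMr// lerDl sqr_ge0.
Qed.

Lemma nrm_peak_decay (V : normedModType R[i]) (v : V) x (e : R[i]) :
  0 <= x <= 1 -> 0 < e ->
  exists A : R, forall t, A < `|t| -> `|peak (x +i* t) *: v| < e.
Proof.
move=> x01 e0.
have eE : e = (complex.Re e)%:C by rewrite RRe_real// gtr0_real.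
have re0 : 0 < complex.Re e by rewrite -ltcR -eE.
have v0 : 0 <= 2 * nrm v / complex.Re e.
  by rewrite divr_ge0 ?mulr_ge0 ?nrm_ge0// ltW.
(* Past this threshold t^2 >= |t| >= 1, and 2 |v| / (1 + t^2) falls below [e]. *)
exists (1 + 2 * nrm v / complex.Re e) => t At.
have t1 : 1 <= `|t| by rewrite ltW// (le_lt_trans _ At)// lerDl.
have tt : `|t| <= t ^+ 2 by rewrite -real_normK ?num_real// expr2 ler_peMr.
have y0 : 0 < 1 + t ^+ 2 by rewrite ltr_pwDl// sqr_ge0.
rewrite eE nrmE ltcR nrmZ.
rewrite (le_lt_trans (ler_wpM2r (nrm_ge0 v) (peak_le _ x01)))//.
rewrite mulrAC ltr_pdivrMr// -ltr_pdivrMl// mulrC; lra.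
Qed.

Lemma peak_pinfty (V : normedModType R[i]) (v : V) x : 0 <= x <= 1 ->
  peak (x +i* t) *: v @[t --> +oo] --> (0 : V).
Proof.
move=> x01; apply/cvgr0Pnorm_lt => e e0.
have [A hA] := nrm_peak_decay v x01 e0.
near=> t; apply: hA; rewrite (lt_le_trans _ (ler_norm t))//.
by near: t; apply: nbhs_pinfty_gt; exact: num_real.
Unshelve. all: by end_near. Qed.

Lemma peak_ninfty (V : normedModType R[i]) (v : V) x : 0 <= x <= 1 ->
  peak (x +i* t) *: v @[t --> -oo] --> (0 : V).
Proof.
move=> x01; apply/cvgr0Pnorm_lt => e e0.
have [A hA] := nrm_peak_decay v x01 e0.
near=> t; apply: hA; rewrite -normrN (lt_le_trans _ (ler_norm _))// ltrNr.
by near: t; apply: nbhs_ninfty_lt; exact: num_real.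
Unshelve. all: by end_near. Qed.

Variables (Y0 Y1 : completeNormedModType R[i]) (j : Y0 -> Y1).
Hypothesis hj : contractive_inclusion j.

Lemma contractive_inclusionZ a y : j (a *: y) = a *: j y.
Proof.
have [lj _ _] := hj.
have j0 : j 0 = 0 by have := lj (-1) 0 0; rewrite scaler0 addr0 scaleN1r addNr.
by have := lj a y 0; rewrite addr0 j0 addr0.
Qed.

(** Any admissible function with value [j y] at [theta] bounds the infimum, and [peak] times a fixed
    vector is one. On the line Re z = 1, contractivity of [j] brings the norm in [Y1] back to that
    of [y]. *)
Lemma interpolation_norm_le (y : Y0) :
  (interpolation_norm j theta (j y) <= (2 * nrm y)%:E)%E.
Proof.
have [_ _ jle] := hj.
have x0 : 0 <= (0 : R) <= 1 by rewrite lexx ler01.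
have x1 : 0 <= (1 : R) <= 1 by rewrite lexx ler01.
pose f0 t := peak (0 +i* t) *: y.
pose f z := peak z *: j y.
have cline (V : normedModType R[i]) (v : V) x : 0 <= x <= 1 ->
    continuous (fun t : R => peak (x +i* t) *: v).
  by move=> x01 t; apply: cvgZr_tmp; exact: continuous_peak_line.
apply: (@le_trans _ _ (calderon_norm f0 f)).
  apply: ereal_inf_lbound; exists f0, f; split => //; last first.
    by rewrite /f peak_theta scale1r.
  split.
  - apply: continuous_in_subspaceT => z; rewrite inE => hz.
    exact: continuous_peakZ.
  - by exists (2 * nrm (j y)) => z hz; exact: nrm_peak_le.
  - move=> z /andP[z0 z1]; have cz : closed_strip z by rewrite /closed_strip/= !ltW.
    exact: derivable_peakZ.
  - by move=> t; rewrite /f0 contractive_inclusionZ.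
  - exact: cline.
  - exact: peak_pinfty.
  - exact: peak_ninfty.
  - exact: cline.
  - exact: peak_pinfty.
  - exact: peak_ninfty.
rewrite /calderon_norm ge_max; apply/andP; split.
  by apply: ge_ereal_sup => _ [t _ <-]; rewrite lee_fin nrm_peak_le.
apply: ge_ereal_sup => _ [t _ <-]; rewrite lee_fin (le_trans (nrm_peak_le _ _))//.
by rewrite ler_pM2l// jle.
Qed.

End interpolation_bound.

(** * Chebyshev's inequality for the trace *)

Section trace.
Variables (R : realType) (H : completeNormedModType R[i]).
Variable dot : {dot H for @Num.conj R[i]}.
Hypothesis hH : hilbert_norm dot.
Variable M : set (H -> H).
Hypothesis hM : von_Neumann dot M.
Variable tau : (H -> H) -> R[i].
Hypothesis htau : normal_faithful_tracial_state dot M tau.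

Lemma trace0 : tau 0 = 0.
Proof.
have M0 := von_Neumann0 hM.
have := trace_linear htau (-1) M0 M0.
by rewrite scaler0 addr0 scaleN1r addNr.
Qed.

Lemma trace_le (k : R) (a b : H -> H) : M a -> M b -> le_op dot (k%:C *: a) b ->
  k * complex.Re (tau a) <= complex.Re (tau b).
Proof.
move=> Ma Mb ab.
have := trace_linear htau (- k%:C) Ma Mb.
have : 0 <= tau ((- k%:C) *: a + b).
  apply: (trace_positive htau); first exact: (von_NeumannP hM).
  by move=> x; have := ab x; rewrite scaleNr addrC.
move=> /[swap] ->; rewrite lecE => /andP[_]; rewrite scaleNr.
have -> : k%:C *: (tau a : R[i]^o) = k%:C * tau a by [].
by case: (tau a) (tau b) => a1 a2 [b1 b2] /=; rewrite mul0r subr0 addrC subr_ge0.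
Qed.

Lemma borel_calculus_in f a : M (borel_calculus dot M f a).
Proof.
rewrite /borel_calculus; case: xgetP => [b _ []//|_].
(* The default value of [borel_calculus] is 0, which lies in [M]. *)
exact: (von_Neumann0 hM).
Qed.

Lemma op_abs_in a : M (op_abs dot M a).
Proof. exact: borel_calculus_in. Qed.

Lemma trace_borel_calculus_ge0 f a : (forall s, 0 <= f s) ->
  0 <= complex.Re (tau (borel_calculus dot M f a)).
Proof.
(* Zero is written as 0 times the trace of 0, to fit [trace_le]. *)
move=> f0; rewrite -(mulr0 0) -[X in 0 * X]/(complex.Re 0) -trace0.
apply: trace_le; [exact: (von_Neumann0 hM)|exact: borel_calculus_in|].
move=> x; rewrite scaler0 subr0 /borel_calculus.
case: xgetP => [b _ [Mb bE]|_]; last by rewrite linear0l.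
have [mu [_ _ ->]] := bE x.
by rewrite ler0c; exact: Rintegral_ge0.
Qed.

(* [s `^ p] is 1, not 0, at negative s. *)
Lemma powR_bounded_above (p C : R) : 0 <= p ->
  exists N, forall s, s <= C -> s `^ p <= N.
Proof.
move=> p0; exists (1 + `|C| `^ p) => s sC.
have [s0|s0] := leP 0 s.
  rewrite (@le_trans _ _ (`|C| `^ p)) ?lerDr//.
  by apply: ge0_ler_powR; rewrite ?nnegrE// (le_trans sC)// ler_norm.
by rewrite [s `^ p]/powR lt_eqF// (ln0 (ltW s0)) mulr0 expR0 lerDl powR_ge0.
Qed.

(** The pointwise inequality t^p 1_(t,oo)(s) <= s^p, integrated against the spectral measure of [h],
    becomes an operator inequality, which the trace preserves. The default values of the calculus
    form separate cases. *)
Lemma trace_Chebyshev (h : H -> H) (t p : R) : M h -> 0 < t -> 0 <= p ->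
  t `^ p * complex.Re (tau (spectral_proj_gt dot M t h)) <=
  complex.Re (tau (borel_calculus dot M (fun s => s `^ p) h)).
Proof.
move=> Mh t0 p0.
have pow0 (s : R) : 0 <= s `^ p by exact: powR_ge0.
pose A : set R := `]t, +oo[%classic.
have mA : measurable A by exact: measurable_itv.
have rhs0 := trace_borel_calculus_ge0 h pow0.
rewrite /spectral_proj_gt {1}/borel_calculus.
(* If no operator represents the indicator, the spectral projection is the default 0 and the left
   side vanishes. *)
case: xgetP => [b _ [Mb bE]|_]; last by rewrite trace0 mulr0.
(* Without a spectral measure for h, the default E = 0 forces b = 0. *)
move: bE; rewrite /spectral_measure; case: xgetP => [E EE [pvm hE] bE|_ bE].
  have Epow := spectral_integral_exists hH hM pvm Mh hE (measurable_powR p) pow0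
    (fun C => powR_bounded_above C p0).
  rewrite /borel_calculus /spectral_measure -EE.
  case: xgetP => [c _ [Mc cE]|nE]; last by have [c Mc cE] := Epow; case: (nE c).
  apply: trace_le => // x.
  have [mu [muE imu bx]] := bE x.
  have [nu [nuE inu cx]] := cE x.
  rewrite -[(_ - _) x]/(c x - (t `^ p)%:C *: b x) dotBl dotZl cx bx.
  rewrite -rmorphM -rmorphB ler0c subr_ge0.
  (* Each operator comes with its own measure; [mu] and [nu] agree on Borel sets, both being B |->
     <E(B) x, x>. *)
  have -> : \int[mu]_(s in setT) \1_A s = \int[nu]_(s in setT) (\1_A s : R).
    by congr fine; apply: eq_measure_integral => B mB _; rewrite muE// nuE.
  have iA : nu.-integrable setT (EFin \o (\1_A : R -> R)).
    apply: (@bounded_integrable _ _ _ nu _ _ 1) => [||s].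
    - by rewrite nuE// ltry.
    - exact: measurable_indic.
    by rewrite indicE; case: (_ \in _); rewrite ?normr1 ?normr0.
  rewrite -RintegralZl//; apply: le_Rintegral => //.
    apply: (eq_integrable measurableT (fun s => (t `^ p)%:E * (\1_A s)%:E)%E).
      by move=> s _; rewrite /= EFinM.
    exact: integrableZl.
  move=> s _; rewrite indicE; have [|_] := boolP (s \in A); last by rewrite mulr0.
  rewrite mulr1 inE /A/= in_itv/= andbT => ts.
  by apply: ge0_ler_powR; rewrite ?nnegrE ?(ltW t0) ?(ltW ts) ?(ltW (lt_trans t0 ts)).
apply: le_trans rhs0; rewrite -[X in _ <= X]/(complex.Re 0) -trace0.
apply: trace_le => //; first exact: (von_Neumann0 hM).
move=> x; rewrite sub0r -[(- _) x]/(- ((t `^ p)%:C *: b x)).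
have [mu [muE _ bx]] := bE x.
have int0 : \int[mu]_(s in setT) (\1_A s : R) = 0.
  by rewrite Rintegral_indic// muE//= linear0l.
by rewrite -(scaleNr (t `^ p)%:C (b x)) dotZl bx int0 mulr0.
Qed.

End trace.

(** * From the growth of the Lp bounds to the exponential tail *)

Theorem theorem8p1 (R : realType) (alpha beta : R)
    (halpha : 0 <= alpha) (hbeta : 0 < beta) :
  exists2 c : R, 0 < c & forall p0 : R, 1 < p0 ->
  exists2 T : R, 0 < T &
  forall (H : completeNormedModType R[i]) (dot : {dot H for @Num.conj R[i]})
    (hH : hilbert_norm dot)
    (M : set (H -> H)) (hM : von_Neumann dot M)
    (tau : (H -> H) -> R[i])
    (htau : normal_faithful_tracial_state dot M tau)
    (Yinfty Y1 : completeNormedModType R[i]) (j : Yinfty -> Y1)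
    (hj : contractive_inclusion j)
    (L : R -> completeNormedModType R[i]) (iota : forall p, (H -> H) -> L p)
    (hL : forall p, 1 < p ->
       is_noncommutative_Lp dot M tau p (iota p))
    (Pp : forall p, L p -> L p)
    (hPp : forall p, 1 < p -> bounded_projection (Pp p))
    (P : (H -> H) -> (H -> H))
    (hPM : forall x, M x -> M (P x)) (hPlin : linear_on M P)
    (hPP : forall p x, 1 < p -> M x -> Pp p (iota p x) = iota p (P x))
    (dom : set (H -> H)) (hdom : subspace_set dom) (hdomM : dom `<=` M)
    (del : (H -> H) -> Yinfty) (hdel : linear_on dom del)
    (K : R) (hK : 0 < K)
    (hbound : forall p, p0 <= p -> forall x, dom x ->
       ((nrm (iota p (x - P x)))%:E <=
          (K * p `^ beta * ln p `^ alpha)%:E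
            * interpolation_norm j p^-1 (j (del x)))%E),
  forall x, dom x -> 0 < nrm (del x) ->
  forall t : R, T * K * nrm (del x) <= t ->
  complex.Re (tau (spectral_proj_gt dot M t (op_abs dot M (x - P x)))) <=
    expR (- c * ((t / (K * nrm (del x))) `^ beta^-1
                  / ln (t / (K * nrm (del x))) `^ (alpha / beta))).
Proof.
(* Both constants are fixed before any space or operator is introduced: [c] depends only on [alpha]
   and [beta], and [T] also on [p0]. *)
have [c c0 hc] := exponent_choice halpha hbeta.
exists c => // p0 p01; have [T T0 hT] := hc p0 p01; exists T => //.
move=> H dot hH M hM tau htau Yinfty Y1 j hj L iota hL Pp hPp P hPM hPlin hPP
  dom hdom hdomM del hdel K hK hbound x domx y0 t Tt.
set y := del x in y0 Tt *; set a := x - P x.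
have Mx : M x by exact: hdomM.
have Ma : M a by apply: (von_NeumannB hM) => //; exact: hPM.
have Ky0 : 0 < K * nrm y by rewrite mulr_gt0.
pose s := t / (K * nrm y).
have Ts : T <= s by rewrite ler_pdivlMr// mulrA.
have s0 : 0 < s by exact: lt_le_trans Ts.
have tE : t = s * (K * nrm y) by rewrite /s divfK ?gt_eqF.
have t0 : 0 < t by rewrite tE mulr_gt0.
rewrite -/s mulNr; have [] := hT s Ts.
set p := c * _ => pp0 hp.
have p1 : 1 < p by exact: lt_le_trans pp0.
have pgt0 : 0 < p by exact: lt_trans p1.
have LpE : nrm (iota p a) = Lp_norm dot M tau p a by exact: Lp_isometric (hL p p1) _ Ma.
pose m := complex.Re (tau (borel_calculus dot M (fun s => s `^ p) (op_abs dot M a))).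
(* Nonnegativity of [m] lets the power p undo the outer power 1/p in [Lp_norm]. *)
have m0 : 0 <= m.
  by apply: (trace_borel_calculus_ge0 hM htau) => r; exact: powR_ge0.
have mE : m = Lp_norm dot M tau p a `^ p.
  by rewrite /Lp_norm -powRrM mulVf ?gt_eqF// powRr1.
(* [hbound] and the factor 2 of the interpolation norm give 2 p^beta (ln p)^alpha K |y|, which the
   choice of [p] makes at most (s / e) K |y| = t / e. *)
have Lp_le : Lp_norm dot M tau p a <= t * expR (- 1).
  have k0 : 0 <= K * p `^ beta * ln p `^ alpha.
    by rewrite !mulr_ge0 ?powR_ge0// ltW.
  have : ((Lp_norm dot M tau p a)%:E <=
      (K * p `^ beta * ln p `^ alpha * (2 * nrm y))%:E)%E.
    rewrite -LpE (le_trans (hbound p pp0 x domx))// [leRHS]EFinM.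
    by apply: lee_wpmul2l; rewrite ?lee_fin//; exact: interpolation_norm_le.
  rewrite lee_fin => /le_trans; apply.
  have -> : K * p `^ beta * ln p `^ alpha * (2 * nrm y) =
    2 * (p `^ beta * ln p `^ alpha) * (K * nrm y) by ring.
  by rewrite tE [leRHS]mulrAC ler_pM2r.
have := trace_Chebyshev hH hM htau (op_abs_in hM a) t0 (ltW pgt0).
rewrite -/m mE => Cheb.
(* After multiplication by t^p and Chebyshev, it remains to compare the p-th power of the Lp norm
   with t^p exp(-p) = (t / e)^p; [p] is exactly the exponent in the conclusion. *)
rewrite -(ler_pM2l (powR_gt0 p t0)) (le_trans Cheb)//.
have -> : expR (- p) = expR (- 1) `^ p by rewrite -expRM mulN1r.
rewrite -powRM ?expR_ge0 ?(ltW t0)//.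
apply: ge0_ler_powR => //; rewrite ?nnegrE ?(ltW pgt0)//.
  by rewrite /Lp_norm powR_ge0.
by rewrite mulr_ge0 ?expR_ge0// ltW.
Qed.
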